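(* Let $H$ be a Hilbert space over $\mathbf K\in\{\mathbb R,\mathbb C\}$. The semigroup $T\mathscr F(H)$ of all normal cones in the normal category $\mathscr F(H)$ of finite-dimensional subspaces of $H$ is isomorphic to the semigroup, under composition, of all finite rank operators (linear maps $H\to H$ with finite-dimensional range, not necessarily bounded) on $H$.
   Context: Composition convention: operators and morphisms are composed left to right, i.e. the product is $(T_1T_2)(x)=T_2(T_1(x))$, and $fg$ means first $f$, then $g$. Category $\mathscr F(H)$: objects are the finite-dimensional subspaces of $H$; morphisms $M\to N$ are all linear maps from $M$ to $N$; the inclusions are the subspace inclusion maps. A retraction is a morphism $q$ with $jq=1$ for some inclusion $j$. A cone $\gamma$ in $\mathscr F(H)$ with vertex $N$ assigns to each object $M$ a morphism $\gamma(M):M\to N$ such that $j\gamma(M)=\gamma(M')$ for every inclusion $j:M'\to M$. The vertex of $\gamma$ is denoted $c_\gamma$. A cone with vertex $N$ is a normal cone if $\gamma(M):M\to N$ is an isomorphism for at least one object $M$. A normal factorization of a morphism $f$ is $f=quj$ with $q$ a retraction, $u$ an isomorphism, and $j$ an inclusion; then $f^\circ=qu$ is the epimorphic component of $f$ (here: $f$ viewed as a map onto its range). The set $T\mathscr F(H)$ of all normal cones is a semigroup under $(\gamma\cdot\sigma)(M)=\gamma(M)\,(\sigma(c_\gamma))^\circ$ for all objects $M$. *)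

(* Defs.v *)
From HB Require Import structures.
From mathcomp Require Import all_boot all_order all_algebra.
From mathcomp Require Import all_classical all_reals all_analysis.
From mathcomp Require Import complex.

Set Implicit Arguments.
Unset Strict Implicit.
Unset Printing Implicit Defensive.

Import GRing.Theory Num.Theory.

Local Open Scope classical_set_scope.
Local Open Scope ring_scope.

(* The inner product is linear in its first argument and theta-semilinear in
   the second one; theta is idfun over the reals and conjc over the complex
   numbers.  Completeness is that of the norm, which the last field ties to the
   inner product. *)
Record hilbertSpace (K : numFieldType) (theta : K -> K) := HilbertSpace {
  hilbert_sort :> completeNormedModType K;
  hilbert_dot : {dot hilbert_sort for theta};
  hilbert_normE : forall x : hilbert_sort, `|x| ^+ 2 = hilbert_dot x x
}.

Section LinearMaps.
Variables (K : fieldType) (U W : lmodType K).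

Definition mk_linear (f : U -> W) (fL : linear f) : {linear U -> W} :=
  HB.pack f (GRing.isLinear.Build K U W *:%R f fL).

Lemma linear_eq (f g : {linear U -> W}) : f =1 g -> f = g.
Proof.
case: f => f [[fA] [fS]]; case: g => g [[gA] [gS]] /= fg.
have {}fg : f = g by apply: funext.
subst g; congr (GRing.Linear.Pack (GRing.Linear.Class _ _));
  by congr (_ _); exact: Prop_irrelevance.
Qed.

Lemma linear_lincomb (f : {linear U -> W}) n
    (c : 'I_n -> K) (x : 'I_n -> U) :
  f (\sum_i c i *: x i) = \sum_i c i *: f (x i).
Proof. by rewrite linear_sum; apply: eq_bigr => i _; rewrite linearZ. Qed.

End LinearMaps.

Section FiniteDimensionalSubspaces.
Variables (K : fieldType) (V : lmodType K).

Definition lin_span (n : nat) (b : 'I_n -> V) : set V :=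
  [set x | exists c : 'I_n -> K, x = \sum_(i < n) c i *: b i].

Definition finite_dim (A : set V) := exists n (b : 'I_n -> V), A = lin_span b.

Record fdSubspace := FdSubspace {
  carrier : set V;
  carrier_closed : submod_closed (mem carrier);
  carrier_finite : finite_dim carrier
}.

Inductive elt (M : fdSubspace) : predArgType := Elt x & x \in carrier M.

Definition elt_val M (u : elt M) : V := let: Elt x _ := u in x.

HB.instance Definition _ M := [isSub of elt M for @elt_val M].
HB.instance Definition _ M := [Choice of elt M by <:].
HB.instance Definition _ (M : fdSubspace) :=
  GRing.SubChoice_isSubLmodule.Build K V (fun x => x \in carrier M) (elt M)
    (GRing.submod_closed_semi (carrier_closed M)).

Lemma elt_valP M (u : elt M) : carrier M (val u).
Proof. exact/set_mem/valP. Qed.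

Lemma fdSubspace_eq (M N : fdSubspace) : carrier M = carrier N -> M = N.
Proof.
case: M N => [A Ac Af] [B Bc Bf] /= AB; subst B.
by congr FdSubspace; exact: Prop_irrelevance.
Qed.

Lemma lin_span_mem n (b : 'I_n -> V) i : lin_span b (b i).
Proof.
exists (fun j => (j == i)%:R).
rewrite (bigD1 i) //= eqxx scale1r big1 ?addr0 // => j /negPf ->.
by rewrite scale0r.
Qed.

Lemma lin_span_closed n (b : 'I_n -> V) : submod_closed (mem (lin_span b)).
Proof.
split; first by apply: mem_set; exists (fun=> 0); rewrite big1 // => i; rewrite scale0r.
move=> a x y /set_mem[c ->] /set_mem[d ->]; apply: mem_set.
exists (fun i => a * c i + d i).
rewrite scaler_sumr -big_split /=; apply: eq_bigr => i _.
by rewrite scalerDl scalerA.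
Qed.

Definition lin_span_subspace n (b : 'I_n -> V) : fdSubspace :=
  FdSubspace (lin_span_closed b) (ex_intro _ n (ex_intro _ b erefl)).

End FiniteDimensionalSubspaces.

Coercion elt : fdSubspace >-> predArgType.

Section Category.
Variables (K : fieldType) (V : lmodType K).
Implicit Types M N P : fdSubspace V.

Lemma val_lincomb M n (c : 'I_n -> K) (x : 'I_n -> M) :
  val (\sum_i c i *: x i) = \sum_i c i *: val (x i).
Proof. by rewrite raddf_sum; apply: eq_bigr. Qed.

Definition incl_fun M N (s : carrier M `<=` carrier N) (x : M) : N :=
  Elt (mem_set (s _ (elt_valP x))).

Fact incl_linear M N (s : carrier M `<=` carrier N) : linear (incl_fun s).
Proof. by move=> a x y; apply: val_inj. Qed.

Definition incl M N (s : carrier M `<=` carrier N) : {linear M -> N} :=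
  mk_linear (incl_linear s).

Definition is_iso M N (u : {linear M -> N}) :=
  exists v : {linear N -> M}, cancel u v /\ cancel v u.

Definition is_retraction M N (q : {linear M -> N}) :=
  exists s : carrier N `<=` carrier M, cancel (incl s) q.

Definition normal_factorization M N M' N' (f : {linear M -> N})
    (q : {linear M -> M'}) (u : {linear M' -> N'})
    (s : carrier N' `<=` carrier N) :=
  [/\ is_retraction q, is_iso u & f =1 incl s \o u \o q].

Definition im M N (f : {linear M -> N}) : set V := range (val \o f).

Fact im_closed M N (f : {linear M -> N}) : submod_closed (mem (im f)).
Proof.
split; first by apply: mem_set; exists 0; rewrite //= linear0.
move=> a _ _ /set_mem[x _ <-] /set_mem[y _ <-]; apply: mem_set.
by exists (a *: x + y); rewrite //= linearP.
Qed.

Fact im_finite M N (f : {linear M -> N}) : finite_dim (im f).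
Proof.
have [n [b Mb]] := carrier_finite M.
have bM i : b i \in carrier M by apply: mem_set; rewrite Mb; exact: lin_span_mem.
pose b' i : M := Elt (bM i).
exists n, (fun i => val (f (b' i))); apply/seteqP; split => [_ [x _ <-]|_ [c ->]].
  have := elt_valP x; rewrite {1}Mb => -[c xc]; exists c.
  have -> : x = \sum_i c i *: b' i by apply: val_inj; rewrite xc val_lincomb.
  by rewrite /= linear_lincomb val_lincomb.
by exists (\sum_i c i *: b' i) => //=; rewrite linear_lincomb val_lincomb.
Qed.

Definition im_subspace M N (f : {linear M -> N}) : fdSubspace V :=
  FdSubspace (im_closed f) (im_finite f).

Definition epi_fun M N (f : {linear M -> N}) (x : M) : im_subspace f :=
  @Elt _ _ (im_subspace f) (val (f x)) (mem_set (ex_intro2 _ _ x I erefl)).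

Fact epi_linear M N (f : {linear M -> N}) : linear (epi_fun f).
Proof. by move=> a x y; apply: val_inj; rewrite /= linearP. Qed.

(* The epimorphic component: f viewed as a map onto its range.  The lemmas
   [epi_normal_factorization] and [normal_factorization_epi] below show that
   this is the composite [u \o q] of every normal factorization of f, and that
   f has one. *)
Definition epi M N (f : {linear M -> N}) : {linear M -> im_subspace f} :=
  mk_linear (epi_linear f).

Lemma epi_surj M N (f : {linear M -> N}) y : exists x, epi f x = y.
Proof.
by have [x _ xy] := elt_valP y; exists x; apply: val_inj.
Qed.

Lemma im_sub M N (f : {linear M -> N}) :
  carrier (im_subspace f) `<=` carrier N.
Proof. by move=> _ [x _ <-]; exact: elt_valP. Qed.

Lemma bij_is_iso M N (f : {linear M -> N}) :
  injective f -> (forall y, exists x, f x = y) -> is_iso f.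
Proof.
move=> finj /choice[g fK].
have gK : cancel f g by move=> x; apply: finj.
by exists (mk_linear (GRing.can2_linear gK fK)).
Qed.

Lemma surj_iso_subspace M N (f : {linear M -> N}) :
  (forall y, exists x, f x = y) ->
  exists P (s : carrier P `<=` carrier M), is_iso (f \o incl s).
Proof.
move=> fsurj.
pose gen n := `[< exists x : 'I_n -> M,
  forall y, exists c : 'I_n -> K, y = f (\sum_i c i *: x i) >].
have exgen : exists n, gen n.
  have [n [b Nb]] := carrier_finite N.
  have bN i : b i \in carrier N by apply: mem_set; rewrite Nb; exact: lin_span_mem.
  have [x xb] := choice (fun i => fsurj (Elt (bN i))).
  exists n; apply/asboolP; exists x => y.
  have := elt_valP y; rewrite {1}Nb => -[c yc]; exists c.
  apply: val_inj; rewrite linear_lincomb val_lincomb yc.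
  by apply: eq_bigr => i _; rewrite xb.
case: (ex_minnP exgen) => n /asboolP[x xgen] nmin.
have free (c : 'I_n -> K) : f (\sum_i c i *: x i) = 0 -> forall i, c i = 0.
  move=> c0 i; apply: contrapT => /eqP ci0.
  case: n i => [[//]|n] i in x xgen nmin c c0 ci0 *.
  suff : gen n by move/nmin; rewrite ltnn.
  apply/asboolP; exists (fun j => x (lift i j)) => y.
  have [d ->] := xgen y.
  exists (fun j => d (lift i j) - d i / c i * c (lift i j)).
  have -> : f (\sum_j d j *: x j) =
      f (\sum_j d j *: x j - (d i / c i) *: \sum_j c j *: x j).
    by rewrite linearB linearZ /= c0 scaler0 subr0.
  congr (f _); rewrite !(bigD1_ord i) //= scalerDr scalerA divfK //.
  rewrite opprD addrACA subrr add0r scaler_sumr -sumrB.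
  by apply: eq_bigr => j _; rewrite scalerBl scalerA.
pose P := lin_span_subspace (val \o x).
have PM : carrier P `<=` carrier M.
  by move=> _ [c ->]; rewrite -val_lincomb; exact: elt_valP.
exists P, PM; apply: bij_is_iso => [|y].
  have inclP (u : P) : exists c : 'I_n -> K, incl PM u = \sum_i c i *: x i.
    by have [c uc] := elt_valP u; exists c; apply: val_inj; rewrite val_lincomb.
  apply: raddf_inj => u fu0; have [c uc] := inclP u.
  have c0 : forall i, c i = 0 by apply: free; rewrite -uc.
  apply: val_inj; transitivity (val (incl PM u)); first by [].
  by rewrite uc big1 // => i _; rewrite c0 scale0r.
have [c ->] := xgen y.
have Pc : \sum_i c i *: val (x i) \in carrier P by apply: mem_set; exists c.
by exists (Elt Pc) => /=; congr (f _); apply: val_inj; rewrite val_lincomb.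
Qed.

Lemma epi_normal_factorization M N (f : {linear M -> N}) :
  exists P (q : {linear M -> P}) (u : {linear P -> im_subspace f}),
    normal_factorization f q u (@im_sub _ _ f) /\ epi f = u \o q :> (_ -> _).
Proof.
have [P [s [v [uv vu]]]] := surj_iso_subspace (@epi_surj _ _ f).
exists P, (v \o epi f), (epi f \o incl s).
have E : epi f = (epi f \o incl s) \o (v \o epi f) :> (_ -> _).
  by apply: funext => x /=; rewrite [RHS]vu.
split=> //; split; first by exists s.
  by exists v.
by move=> x; apply: val_inj; rewrite /= -[LHS]/(val (epi f x)) E.
Qed.

Lemma normal_factorization_epi M N M' N' (f : {linear M -> N})
    (q : {linear M -> M'}) (u : {linear M' -> N'})
    (s : carrier N' `<=` carrier N) : normal_factorization f q u s ->
  im_subspace f = N' /\ forall x, val (epi f x) = val (u (q x)).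
Proof.
move=> [[sq jq] [v [uv vu]] fE]; split=> [|x]; last by rewrite /= fE.
apply: fdSubspace_eq; apply/seteqP; split => [_ [x _ <-]|y Ny].
  by rewrite /= fE /=; exact: elt_valP.
exists (incl sq (v (Elt (mem_set Ny)))) => //.
by rewrite /= fE /= jq vu.
Qed.

End Category.

Section NormalCones.
Variables (K : fieldType) (V : lmodType K).
Implicit Types M N : fdSubspace V.

Record normalCone := NormalCone {
  vertex : fdSubspace V;
  component M : {linear M -> vertex};
  component_natural M' M (s : carrier M' `<=` carrier M) :
    component M \o incl s =1 component M';
  component_normal : exists M, is_iso (component M)
}.

Implicit Types g h : normalCone.

Lemma normalCone_eq g h : carrier (vertex g) = carrier (vertex h) ->
  (forall M (x : M), val (component g M x) = val (component h M x)) -> g = h.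
Proof.
move=> /fdSubspace_eq; case: g h => [A a an ai] [B b bn bi] /= AB; subst B.
move=> ab; have {}ab : a = b.
  by apply: functional_extensionality_dep => M; apply: linear_eq => x; exact/val_inj/ab.
by subst b; congr NormalCone; exact: Prop_irrelevance.
Qed.

Section Product.
Variables g h : normalCone.
Let f := component h (vertex g).

Definition cone_mul_component M : {linear M -> im_subspace f} :=
  epi f \o component g M.

Fact cone_mul_natural M' M (s : carrier M' `<=` carrier M) :
  cone_mul_component M \o incl s =1 cone_mul_component M'.
Proof. by move=> x; congr (epi f _); exact: (component_natural g s). Qed.

Fact cone_mul_normal : exists M, is_iso (cone_mul_component M).
Proof.
have [M [v [gv vg]]] := component_normal g.
have fsurj y : exists x, cone_mul_component M x = y.
  by have [x <-] := epi_surj y; exists (v x); rewrite /= vg.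
have [P [s [w [fw wf]]]] := surj_iso_subspace fsurj.
exists P, w; split=> x; first by rewrite -(cone_mul_natural s); exact: fw.
by rewrite -(cone_mul_natural s); exact: wf.
Qed.

Definition cone_mul : normalCone :=
  NormalCone cone_mul_natural cone_mul_normal.

End Product.

Lemma component_epi g M N (f : {linear M -> N}) x :
  component g (im_subspace f) (epi f x) = component g N (f x).
Proof.
rewrite -(component_natural g (@im_sub _ _ _ _ f)).
by congr (component g N _); exact: val_inj.
Qed.

Fact cone_mulA : associative cone_mul.
Proof.
move=> g h k.
have E x := congr1 (@elt_val _ _ (vertex k))
  (component_epi k (component h (vertex g)) x).
apply: normalCone_eq => [|M x]; last exact/esym/E.
apply/seteqP; split=> [_ [x _ <-]|_ [y _ <-]].
  by exists (epi (component h (vertex g)) x) => //; exact: E.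
by have [x <-] := epi_surj y; exists x => //; exact/esym/E.
Qed.

HB.instance Definition _ := gen_eqMixin normalCone.
HB.instance Definition _ := gen_choiceMixin normalCone.
HB.instance Definition _ := isSemigroup.Build normalCone cone_mulA.

End NormalCones.

Section FiniteRankOperators.
Variables (K : fieldType) (V : lmodType K).

Record finiteRankOp := FiniteRankOp {
  operator :> {linear V -> V};
  operator_finite_rank : finite_dim (range operator)
}.

Lemma finiteRankOp_eq (S T : finiteRankOp) : S =1 T -> S = T.
Proof.
case: S T => [S Sf] [T Tf] /= /linear_eq ST; subst T.
by congr FiniteRankOp; exact: Prop_irrelevance.
Qed.

Fact op_mul_finite_rank (S T : finiteRankOp) : finite_dim (range (T \o S)).
Proof.
have [n [b Sb]] := operator_finite_rank S; exists n, (T \o b).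
rewrite (_ : range _ = T @` range S); last first.
  apply/seteqP; split=> [_ [x _ <-]|_ [_ [x _ <-] <-]]; last by exists x.
  by exists (S x) => //; exists x.
rewrite Sb; apply/seteqP; split=> [_ [_ [c ->] <-]|_ [c ->]].
  by exists c; rewrite linear_lincomb.
by exists (\sum_i c i *: b i); [exists c | rewrite linear_lincomb].
Qed.

(* Composition is written from left to right: first S, then T. *)
Definition op_mul (S T : finiteRankOp) : finiteRankOp :=
  FiniteRankOp (op_mul_finite_rank S T).

Fact op_mulA : associative op_mul.
Proof. by move=> S T U; apply: finiteRankOp_eq. Qed.

HB.instance Definition _ := gen_eqMixin finiteRankOp.
HB.instance Definition _ := gen_choiceMixin finiteRankOp.
HB.instance Definition _ := isSemigroup.Build finiteRankOp op_mulA.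

End FiniteRankOperators.

Definition semigroup_isomorphic (G H : semigroupType) :=
  exists phi : {multiplicative G -> H}, bijective phi.

(* Main.v *)
Require Import Defs.
From HB Require Import structures.
From mathcomp Require Import all_boot all_order all_algebra.
From mathcomp Require Import all_classical all_reals all_analysis.
From mathcomp Require Import complex.

(** A cone is a compatible family of linear maps on the finite-dimensional
    subspaces, and these cover V: it glues to a single linear operator on V,
    whose value at x may be computed on the line through x, and whose range is
    the vertex because some component is onto.  Conversely an operator of finite
    rank restricts to a cone with its range as vertex.  Only the vector space
    structure of the Hilbert space matters. *)

Set Implicit Arguments.
Unset Strict Implicit.
Unset Printing Implicit Defensive.

Import GRing.Theory.

Local Open Scope classical_set_scope.
Local Open Scope ring_scope.

Section ConesAndOperators.
Variables (K : fieldType) (V : lmodType K).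
Implicit Types (M : fdSubspace V) (g h : normalCone V) (T : finiteRankOp V).

Lemma lin_span_sub n (b : 'I_n -> V) M :
  (forall i, carrier M (b i)) -> lin_span b `<=` carrier M.
Proof.
move=> bM _ [c ->].
have := elt_valP (\sum_i c i *: Elt (mem_set (bM i))).
by rewrite val_lincomb.
Qed.

Definition gen_elt n (b : 'I_n -> V) i : lin_span_subspace b :=
  Elt (mem_set (lin_span_mem b i) : b i \in carrier (lin_span_subspace b)).

Definition cone_op_fun g (x : V) : V :=
  val (component g (lin_span_subspace (fun=> x)) (gen_elt (fun=> x) (@ord0 0))).

(** Naturality along the inclusion into [M] of the line through [x]. It frees the operator from the
    choice of the line: any subspace containing the vector will do. *)
Lemma cone_op_funE g M (x : M) : cone_op_fun g (val x) = val (component g M x).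
Proof.
have s : carrier (lin_span_subspace (fun _ : 'I_1 => val x)) `<=` carrier M.
  by apply: lin_span_sub => _; exact: elt_valP.
rewrite /cone_op_fun -(component_natural g s) /=.
by congr (val (component g M _)); exact: val_inj.
Qed.

Fact cone_op_linear g : linear (cone_op_fun g).
Proof.
(* The three vectors [x], [y] and [a *: x + y] all lie in the span of [b], so linearity of the
   single component there suffices. *)
move=> a x y; pose b (i : 'I_2) := if i == ord0 then x else y.
rewrite -[x]/(val (gen_elt b ord0)) -[y]/(val (gen_elt b ord_max)).
rewrite -[_ *: _ + _]/(val (a *: gen_elt b ord0 + gen_elt b ord_max)).
by rewrite !cone_op_funE linearP.
Qed.

Lemma range_cone_op g : range (cone_op_fun g) = carrier (vertex g).
Proof.
apply/seteqP; split=> [_ [x _ <-]|y gy]; first exact: elt_valP.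
have [M [v [_ vK]]] := component_normal g.
by exists (val (v (Elt (mem_set gy)))) => //; rewrite cone_op_funE vK.
Qed.

Fact cone_op_finite_rank g : finite_dim (range (mk_linear (@cone_op_linear g))).
Proof. by rewrite range_cone_op; exact: carrier_finite. Qed.

Definition cone_op g : finiteRankOp V := FiniteRankOp (@cone_op_finite_rank g).

Fact range_closed T : submod_closed (mem (range T)).
Proof.
split; first by apply: mem_set; exists 0; rewrite ?linear0.
move=> a _ _ /set_mem[x _ <-] /set_mem[y _ <-]; apply: mem_set.
by exists (a *: x + y); rewrite ?linearP.
Qed.

Definition range_subspace T : fdSubspace V :=
  FdSubspace (@range_closed T) (operator_finite_rank T).

Definition op_cone_fun T M (x : M) : range_subspace T :=
  @Elt _ _ (range_subspace T) (T (val x)) (mem_set (imageT T (val x))).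

Fact op_cone_linear T M : linear (@op_cone_fun T M).
Proof. by move=> a x y; apply: val_inj; rewrite /= linearP. Qed.

Definition op_cone_component T M : {linear M -> range_subspace T} :=
  mk_linear (@op_cone_linear T M).

Fact op_cone_natural T M' M (s : carrier M' `<=` carrier M) :
  op_cone_component T M \o Defs.incl s =1 op_cone_component T M'.
Proof. by move=> x; exact: val_inj. Qed.

Fact op_cone_normal T : exists M, is_iso (op_cone_component T M).
Proof.
have [n [b Tb]] := operator_finite_rank T.
(* Preimages of vectors spanning the range of [T] span a finite-dimensional subspace that [T] still
   maps onto this range. *)
have /choice[x xb] i : exists x, T x = b i.
  have : range T (b i) by rewrite Tb; exact: lin_span_mem.
  by case=> x _ <-; exists x.
have surj y : exists u, op_cone_component T (lin_span_subspace x) u = y.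
  have : range T (val y) := elt_valP y; rewrite Tb => -[c yc].
  exists (\sum_i c i *: gen_elt x i); apply: val_inj.
  by rewrite /= val_lincomb linear_lincomb yc; apply: eq_bigr => i _; rewrite xb.
(* That span is cut down to a subspace [P] on which [T] is also injective; by naturality the
   restriction is the component at [P]. *)
have [P [s [v [uv vu]]]] := surj_iso_subspace surj.
by exists P, v; split=> y; rewrite -(op_cone_natural T s); [exact: uv | exact: vu].
Qed.

Definition op_cone T : normalCone V :=
  NormalCone (@op_cone_natural T) (op_cone_normal T).

Lemma cone_opK : cancel cone_op op_cone.
Proof.
move=> g; apply: normalCone_eq => [|M x]; first exact: range_cone_op.
exact: cone_op_funE.
Qed.

Lemma op_coneK : cancel op_cone cone_op.
Proof. by move=> T; exact: finiteRankOp_eq. Qed.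

(** The epimorphic component changes only the codomain, which [val] forgets; what remains is
    [cone_op h] evaluated through its component at [vertex g], where the values of [g] lie. *)
Fact cone_op_mul : {morph cone_op : g h / (g * h)%g >-> (g * h)%g}.
Proof.
by move=> g h; apply: finiteRankOp_eq => x; rewrite /= cone_op_funE.
Qed.

HB.instance Definition _ :=
  isMultiplicative.Build (normalCone V) (finiteRankOp V) cone_op cone_op_mul.

Lemma normalCone_finiteRankOp_isomorphic :
  semigroup_isomorphic (normalCone V) (finiteRankOp V).
Proof. by exists cone_op; exact: Bijective cone_opK op_coneK. Qed.

End ConesAndOperators.

Theorem theorem5p1 (R : realType) :
  (forall H : hilbertSpace (@idfun R),
     semigroup_isomorphic (normalCone H) (finiteRankOp H)) /\
  (forall H : hilbertSpace (@conjc R),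
     semigroup_isomorphic (normalCone H) (finiteRankOp H)).
Proof. by split=> H; exact: normalCone_finiteRankOp_isomorphic. Qed.
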